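(* Let $\mathbf{k}$ be a commutative ring, let $\lambda\in\mathbf{k}$, let $(R,R_n,P)$ be a commutative complete filtered Rota-Baxter algebra over $\mathbf{k}$ of weight $\lambda$, and let $a_0,a_1\in R_1$ be fixed. Consider the equation $$b = P((1+\lambda a_1)a_0) + P(a_1 b)$$ for an unknown $b\in R$. (i) If $\lambda$ is not a zero divisor of $R$, then the equation has a unique solution, namely $$b = \exp\left(P\left(\lambda^{-1}\log(1+\lambda a_1)\right)\right)\, P\left(\exp\left(-P\left(\lambda^{-1}\log(1+\lambda a_1)\right)\right)a_0\right),$$ and moreover $$\sum_{n=0}^\infty \underbrace{P(a_1\cdots P(a_1}_{n}P((1+\lambda a_1)a_0))\cdots) = \exp\left(P\left(\lambda^{-1}\log(1+\lambda a_1)\right)\right)\, P\left(\exp\left(-P\left(\lambda^{-1}\log(1+\lambda a_1)\right)\right)a_0\right).$$ (ii) If $\lambda=0$, then the equation has a unique solution, namely $$b=\exp(P(a_1))\,P(\exp(-P(a_1))a_0),$$ and moreover $$\sum_{n=0}^\infty \underbrace{P(a_1\cdots P(a_1}_{n}P(a_0))\cdots) = \exp(P(a_1))\,P(\exp(-P(a_1))a_0).$$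
   Context: All algebras are associative and unital. A Rota-Baxter algebra of weight $\lambda\in\mathbf{k}$ over a commutative ring $\mathbf{k}$ is a pair $(R,P)$ where $R$ is a $\mathbf{k}$-algebra and $P:R\to R$ is a linear operator with $P(x)P(y)=P(xP(y))+P(P(x)y)+\lambda P(xy)$ for all $x,y\in R$; it is commutative if $R$ is commutative. A filtered algebra is an algebra $R$ with non-unitary subalgebras $R_n\subset R$, $n\in\mathbb{N}\cup\{0\}$, such that $R_0=R$, $R_{n+1}\subset R_n$, $\bigcap_n R_n=\{0\}$ and $R_nR_m\subset R_{n+m}$ for all $n,m$. It is complete if the metric $d(x,y)=\inf\{2^{-n} : x-y\in R_n\}$ is complete. $(R,R_n,P)$ is a complete filtered Rota-Baxter algebra of weight $\lambda$ if $(R,P)$ is a Rota-Baxter algebra of weight $\lambda$, $R$ with $(R_n)$ is a complete filtered algebra, and $P(R_n)\subset R_n$ for all $n\ge 0$. Infinite sums are limits in the metric $d$. The functions $\exp:R_1\to R$ and $\log:1+R_1\to R$ are given by the standard formulas $\exp(x)=\sum_{n\ge0}x^n/n!$ and $\log(1+x)=-\sum_{n\ge1}\frac{(-1)^n}{n}x^n$. The expression $\lambda^{-1}\log(1+\lambda a)$ is an abbreviation for $\sum_{n=1}^\infty \frac{(-\lambda)^{n-1}}{n}a^n$ for $a\in R_1$ ($\lambda$ need not be invertible). ''$\lambda$ is not a zero divisor of $R$'' means that $\lambda x=0$ with $x\in R$ implies $x=0$. Iterated notation: for $c\in R$, the element $T_n=\underbrace{P(a_1\cdots P(a_1}_{n}P(c))\cdots)$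 is defined by $T_0=P(c)$ and $T_{n+1}=P(a_1T_n)$.
   Formalization: The formal theorem adds the assumption that every positive integer is invertible in R, so that the terms x^n/n! and a^n/n in exp and log are defined; this is automatic when k contains the rationals. *)

(* Defs.v *)
From HB Require Import structures.
From mathcomp Require Import all_boot all_order all_algebra.
From mathcomp Require Import all_classical all_reals all_analysis.

Set Implicit Arguments.
Unset Strict Implicit.
Unset Printing Implicit Defensive.

Import Order.TTheory GRing.Theory Num.Theory.

Local Open Scope classical_set_scope.
Local Open Scope ring_scope.

(* Non-unitary subalgebras are the submodules closed under multiplication.    *)
Record filtration (k : comPzRingType) (R : algType k) := Filtration {
  fil :> nat -> {pred R};
  fil_submod : forall n, submod_closed (fil n);
  fil_mul_closed : forall n, GRing.mulr_2closed (fil n);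
  fil0 : forall x, x \in fil 0;
  filS : forall n, {subset fil n.+1 <= fil n};
  fil_sep : forall x, (forall n, x \in fil n) -> x = 0;
  filM : forall n m x y, x \in fil n -> y \in fil m -> x * y \in fil (n + m)%N
}.

Definition fdist (K : realType) (k : comPzRingType) (R : algType k)
    (F : filtration R) (x y : R) : K :=
  inf [set (2 ^- n : K) | n in [set n | x - y \in F n]].

Section fdist_theory.
Context (K : realType) (k : comPzRingType) (R : algType k) (F : filtration R).
Implicit Types x y z : R.

Let E x y : set K := [set (2 ^- n : K) | n in [set n | x - y \in F n]].

Let filN n x : x \in F n -> - x \in F n.
Proof.
move=> xF; have [F0 Flin] := fil_submod F n.
by have := Flin (-1) x 0 xF F0; rewrite scaleN1r addr0.
Qed.

Let filD n x y : x \in F n -> y \in F n -> x + y \in F n.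
Proof.
move=> xF yF; have [F0 Flin] := fil_submod F n.
by have := Flin 1 x y xF yF; rewrite scale1r.
Qed.

Let fil_le n m x : (n <= m)%N -> x \in F m -> x \in F n.
Proof.
move=> /subnK <-; elim: (m - n)%N => [//|j IH].
by rewrite addSn => /filS; exact: IH.
Qed.

Let E0 x y : E x y !=set0.
Proof. by exists (2 ^- 0), 0%N => //=; exact: fil0. Qed.

Let E_lb x y c : (forall n, x - y \in F n -> c <= 2 ^- n) -> c <= fdist K F x y.
Proof. by move=> H; apply: lb_le_inf (E0 x y) _ => _ [n /= nF <-]; exact: H. Qed.

Let fdist_le x y n : x - y \in F n -> fdist K F x y <= 2 ^- n.
Proof.
move=> nF; apply: ge_inf; last by exists n.
by exists 0 => _ [m _ <-]; rewrite invr_ge0 exprn_ge0.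
Qed.

Let fdist_ge0 x y : 0 <= fdist K F x y.
Proof. by apply: E_lb => n _; rewrite invr_ge0 exprn_ge0. Qed.

Lemma fdistxx x : fdist K F x x = 0.
Proof.
apply/eqP; rewrite eq_le fdist_ge0 andbT; apply/ler_addgt0Pl => e e0.
rewrite addr0; have e1 : 0 <= e^-1 by rewrite invr_ge0 ltW.
pose n := Num.bound e^-1; apply: (@le_trans _ _ (2 ^- n)).
  by apply: fdist_le; rewrite subrr; case: (fil_submod F n).
rewrite -[leRHS]invrK lef_pV2 ?posrE ?invr_gt0 ?exprn_gt0//.
apply: (le_trans (ltW (archi_boundP e1))).
by rewrite -natrX ler_nat ltnW// ltn_expl.
Qed.

Lemma fdist_positivity x y : fdist K F x y = 0 -> x = y.
Proof.
move=> d0; apply/eqP; rewrite -subr_eq0; apply/eqP/(fil_sep (f := F)) => N.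
apply: contrapT => /negP NF; have : 2 ^- N <= fdist K F x y.
  apply: E_lb => n nF; rewrite lef_pV2 ?posrE ?exprn_gt0// ler_eXn2l ?ltr1n//.
  by rewrite leqNgt; apply: contra NF => /ltnW /fil_le; apply.
by rewrite d0 leNgt invr_gt0 exprn_gt0.
Qed.

Lemma fdist_sym x y : fdist K F x y = fdist K F y x.
Proof.
by apply/le_anti/andP; split; apply: E_lb => n /filN; rewrite opprB;
  exact: fdist_le.
Qed.

Lemma fdist_triangle y x z : fdist K F x z <= fdist K F x y + fdist K F y z.
Proof.
rewrite -lerBlDr; apply: E_lb => n nF; rewrite lerBlDr -lerBlDl.
apply: E_lb => m mF; rewrite lerBlDl.
have pos j : 0 <= 2 ^- j :> K by rewrite invr_ge0 exprn_ge0.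
have xz : x - z = (x - y) + (y - z) by rewrite addrA subrK.
have [nm|/ltnW mn] := leqP n m.
  apply: (@le_trans _ _ (2 ^- n)); last by rewrite lerDl.
  by apply: fdist_le; rewrite xz filD// (fil_le nm).
apply: (@le_trans _ _ (2 ^- m)); last by rewrite lerDr.
by apply: fdist_le; rewrite xz filD// (fil_le mn).
Qed.

End fdist_theory.

(* A copy of R carrying the metric fdist, hence the library's notions of      *)
(* limit and of Cauchy sequence for that metric.                              *)
Definition fspace (K : realType) (k : comPzRingType) (R : algType k)
  (F : filtration R) : Type := R.

HB.instance Definition _ (K : realType) (k : comPzRingType) (R : algType k)
  (F : filtration R) := Choice.copy (fspace K F) R.
HB.instance Definition _ (K : realType) (k : comPzRingType) (R : algType k)
  (F : filtration R) := isPointed.Build (fspace K F) (0 : R).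
HB.instance Definition _ (K : realType) (k : comPzRingType) (R : algType k)
  (F : filtration R) := @isMetric.Build K (fspace K F) (@fdist K k R F)
    (@fdistxx K k R F) (@fdist_positivity K k R F) (@fdist_sym K k R F)
    (@fdist_triangle K k R F).

Definition complete_filtration (K : realType) (k : comPzRingType)
    (R : algType k) (F : filtration R) : Prop :=
  forall u : nat -> fspace K F, cauchy (u @ \oo) -> cvgn u.

Definition rota_baxter (k : comPzRingType) (R : algType k) (lambda : k)
    (P : R -> R) : Prop :=
  forall x y, P x * P y = P (x * P y) + P (P x * y) + lambda *: P (x * y).

Definition complete_filtered_rota_baxter (K : realType) (k : comPzRingType)
    (R : algType k) (lambda : k) (F : filtration R) (P : {linear R -> R}) :
    Prop :=
  [/\ rota_baxter lambda P, complete_filtration K F &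
      forall n x, x \in F n -> P x \in F n].

Definition fsum_to (K : realType) (k : comPzRingType) (R : algType k)
    (F : filtration R) (u : nat -> R) (s : R) : Prop :=
  (series u : nat -> fspace K F) @ \oo --> (s : fspace K F).

(* Like the library's lim, this is arbitrary if the series diverges.          *)
Definition fsum (K : realType) (k : comPzRingType) (R : algType k)
    (F : filtration R) (u : nat -> R) : R :=
  limn (series u : nat -> fspace K F).

(* In fexp and flog the divisions take place in R, and are meaningful when    *)
(* the positive integers are units of R.                                      *)
Definition fexp (K : realType) (k : comPzRingType) (R : comUnitAlgType k)
    (F : filtration R) (x : R) : R :=
  fsum K F (fun n => x ^+ n / n`!%:R).

(* lambda^-1 log(1 + lambda a), with the summation index shifted to start     *)
(* at 0; lambda itself is never inverted.                                     *)
Definition flog (K : realType) (k : comPzRingType) (R : comUnitAlgType k)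
    (F : filtration R) (lambda : k) (a : R) : R :=
  fsum K F (fun n => (- lambda) ^+ n *: (a ^+ n.+1 / n.+1%:R)).

Definition nested (k : comPzRingType) (R : algType k) (P : R -> R) (a c : R)
    (n : nat) : R :=
  iter n (fun t => P (a * t)) (P c).

(* Main.v *)
Require Import Defs.
From HB Require Import structures.
From mathcomp Require Import all_boot all_order all_algebra.
From mathcomp Require Import all_classical all_reals all_analysis.
From mathcomp Require Import ring.

(** A solution of [b = P c + P (a b)] is determined modulo every term of the
    filtration, since [b |-> P (a b)] raises the degree when [a] has degree 1;
    iterating the equation also exhibits the solution as the sum of the nested
    terms ([fixed_point_unique], [fixed_point_nested]).  So it suffices to check
    that the closed formula solves the equation.

    The closed formula has the form [b = e P (e^-1 c)], the variation of
    constants for a solution [e] of the homogeneous problem [e = 1 + P (a e)]: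
    the Rota-Baxter identity for the product [P (a e) P (e^-1 c)] turns the
    latter equation into [b = P ((1 + lambda a) c) + P (a b)]
    ([solution_of_factor]).

    It remains to see that [e = exp (P x)], with
    [x = lambda^-1 log (1 + lambda a)], satisfies [e = 1 + P (a e)].  This is
    Spitzer's identity ([spitzer]).  The bilinear operation
    [star x y = x P y + P x y + lambda x y] is made so that both [P] and
    [lambda + P] turn it into the product of [R]; hence the exponential
    series [w] of [x] for this operation, without constant term, satisfies
    [P w = exp (P x) - 1] and
    [lambda w + P w = exp (lambda x) exp (P x) - 1].  As
    [exp (lambda x) = 1 + lambda a], subtracting gives [lambda w = lambda a e];
    if [lambda] is regular then [w = a e], and the value of [P w] is the claim.
    If [lambda = 0], nothing can be cancelled, but then [x = a] and
    [P (a (P a)^n / n!) = (P a)^(n+1) / (n+1)!] for each [n]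
    ([spitzer_weight0]).

    Identities between infinite series are proved modulo [F n] for every [n]:
    there a series whose [i]-th term lies in [F i] becomes a finite sum
    ([fsum_tail]), and [exp (x + y) = exp x exp y] and
    [exp (log (1 + x)) = 1 + x] become statements about coefficients of
    polynomials. *)

Set Implicit Arguments.
Unset Strict Implicit.
Unset Printing Implicit Defensive.

Import Order.TTheory GRing.Theory Num.Theory.

Local Open Scope ring_scope.

(** * Filtrations and their limits *)

HB.instance Definition _ (k : comPzRingType) (R : algType k)
    (F : filtration R) (n : nat) :=
  GRing.isSubmodClosed.Build k R (fil F n) (fil_submod F n).

Section Filtration.
Context (k : comPzRingType) (R : algType k) (F : filtration R).
Implicit Types (x y z : R) (m n : nat).

Lemma fil_le m n x : (m <= n)%N -> x \in F n -> x \in F m.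
Proof.
move=> /subnK <-; elim: (n - m)%N => [//|j IH].
by rewrite addSn => /filS; exact: IH.
Qed.

Lemma fil_eq x y : (forall n, x - y \in F n) -> x = y.
Proof. by move=> xy; apply/eqP; rewrite -subr_eq0; apply/eqP/(fil_sep xy). Qed.

(** The terms of the filtration are ideals because [F 0] is everything. *)
Lemma filMl n x y : y \in F n -> x * y \in F n.
Proof. by move=> yF; have := filM (fil0 F x) yF. Qed.

Lemma filMr n x y : x \in F n -> x * y \in F n.
Proof. by move=> xF; have := filM xF (fil0 F y); rewrite addn0. Qed.

Lemma filX n x : x \in F 1%N -> x ^+ n \in F n.
Proof.
move=> xF; elim: n => [|n IH]; first exact: fil0.
by rewrite exprS -add1n filM.
Qed.

Lemma fil_trans n y x z : x - y \in F n -> y - z \in F n -> x - z \in F n.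
Proof. by move=> xy yz; rewrite -(subrKA y) rpredD. Qed.

Lemma fil_subM n x x' y y' : x - x' \in F n -> y - y' \in F n ->
  x * y - x' * y' \in F n.
Proof.
move=> xF yF; apply: (fil_trans (y := x' * y)).
  by rewrite -mulrBl filMr.
by rewrite -mulrBr filMl.
Qed.

Lemma filBC n x y : x - y \in F n -> y - x \in F n.
Proof. by rewrite -opprB rpredN. Qed.

End Filtration.

Section Convergence.
Context (K : realType) (k : comPzRingType) (R : algType k) (F : filtration R).
Implicit Types (x y : R) (n : nat) (u : nat -> R).

Lemma fdist_le n x y : x - y \in F n -> fdist K F x y <= 2 ^- n.
Proof.
move=> xyF; apply: ge_inf; last by exists n.
by exists 0 => _ [m _ <-]; rewrite invr_ge0 exprn_ge0.
Qed.

Lemma fdist_lt n x y : fdist K F x y < 2 ^- n -> x - y \in F n.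
Proof.
apply: contraLR => xyF; rewrite -leNgt; apply: lb_le_inf.
  by exists (2 ^- 0), 0%N => //=; exact: fil0.
move=> _ [m /= mF <-]; rewrite lef_pV2 ?posrE ?exprn_gt0// ler_eXn2l ?ltr1n//.
by rewrite leqNgt; apply: contra xyF => /ltnW /fil_le; exact.
Qed.

Lemma exp2V_lt (e : K) : 0 < e -> exists n, 2 ^- n < e.
Proof.
move=> e0; pose n := Num.bound e^-1; exists n.
rewrite -[ltRHS]invrK ltf_pV2 ?posrE ?invr_gt0 ?exprn_gt0//.
have eV0 : 0 <= e^-1 by rewrite invr_ge0 ltW.
apply: lt_le_trans (archi_boundP eV0) _.
by rewrite -natrX ler_nat ltnW// ltn_expl.
Qed.

(** Convergence for the metric is convergence modulo every [F n], which is how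
    all the limits below are handled. *)
Lemma fcvgP (u : nat -> fspace K F) (s : fspace K F) :
  (u @ \oo --> s)%classic <->
  forall n, exists m, forall i, (m <= i)%N -> (s : R) - u i \in F n.
Proof.
split=> [/metricType_numDomainType.cvgrPdist_lt us n|us].
  have e0 : 0 < 2 ^- n :> K by rewrite invr_gt0 exprn_gt0.
  have [m _ mP] := us _ e0; exists m => i mi; apply: fdist_lt.
  exact: (mP i mi).
apply/metricType_numDomainType.cvgrPdist_lt => e e0.
have [n ne] := exp2V_lt e0; have [m mP] := us n.
exists m => // i mi; apply: le_lt_trans ne.
exact: fdist_le (mP i mi).
Qed.

Lemma fsum_to_tail u s :
  (forall n, s - \sum_(i < n) u i \in F n) -> fsum_to K F u s.
Proof.
move=> us; apply/fcvgP => n; exists n => i ni.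
by rewrite /series/= big_mkord; apply: fil_le ni _; exact: us.
Qed.

Lemma fil_tail u n m : (n <= m)%N -> (forall i, u i \in F i) ->
  \sum_(i < m) u i - \sum_(i < n) u i \in F n.
Proof.
move=> nm uF; rewrite -!(big_mkord xpredT u) (big_cat_nat (n := n))//=.
rewrite addrAC subrr add0r big_seq rpred_sum// => i.
by rewrite mem_index_iota => /andP[ni _]; apply: fil_le ni _.
Qed.

Hypothesis complF : complete_filtration K F.

(** The partial sums are Cauchy, so completeness provides the limit, and
    closedness of [F n] passes the estimate [fil_tail] to the limit. *)
Lemma fsum_tail u n : (forall i, u i \in F i) ->
  fsum K F u - \sum_(i < n) u i \in F n.
Proof.
move=> uF; have /fcvgP/(_ n)[m mP] : cvgn (series u : nat -> fspace K F).
  apply: complF; apply/cauchy_exP => e e0.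
  have [j je] := exp2V_lt e0; exists (series u j : fspace K F), j => // i /= ji.
  rewrite ballEmdist/=; apply: le_lt_trans je; apply: fdist_le.
  by rewrite /series/= !big_mkord filBC// fil_tail.
have := mP _ (leq_maxl m n); rewrite /series/= big_mkord => mF.
by apply: fil_trans mF _; apply: fil_tail; rewrite ?leq_maxr.
Qed.

End Convergence.

(** * Truncated exponential and logarithm *)

Section ExpLogPolynomials.
Context (R : comUnitRingType).
Hypothesis units_nat : forall n : nat, (n.+1%:R : R) \is a GRing.unit.
Implicit Types (x : R) (n : nat) (p : {poly R}).

Lemma unit_fact n : (n`!%:R : R) \is a GRing.unit.
Proof. by have := units_nat (n`!).-1; rewrite prednK ?fact_gt0. Qed.

Definition exp_poly n : {poly R} := \poly_(i < n) (i`!%:R)^-1.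

Lemma horner_exp_poly n x :
  (exp_poly n).[x] = \sum_(i < n) x ^+ i / i`!%:R.
Proof. by rewrite horner_poly; apply: eq_bigr => i _; rewrite mulrC. Qed.

Definition log_poly n : {poly R} :=
  \sum_(i < n) ((-1) ^+ i / i.+1%:R) *: 'X^(i.+1).

Lemma deriv_log_poly n : (1 + 'X) * (log_poly n)^`() = 1 - (- 'X) ^+ n.
Proof.
have -> : (log_poly n)^`() = \sum_(i < n) (- 'X) ^+ i.
  rewrite raddf_sum; apply: eq_bigr => i _ /=.
  rewrite derivZ derivXn /= -scalerMnr scalerMnl -mulr_natr divrK ?units_nat//.
  by rewrite [RHS]exprNn -mul_polyC rmorphXn rmorphN1.
by rewrite -opprB subrX1 -mulNr opprB opprK.
Qed.

Lemma log_poly_factor n : exists p, log_poly n = 'X * p.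
Proof.
exists (\sum_(i < n) ((-1) ^+ i / i.+1%:R) *: 'X^i); rewrite mulr_sumr.
by apply: eq_bigr => i _; rewrite -scalerAr -exprS.
Qed.

Lemma deriv_exp_poly n : (exp_poly n.+1)^`() = exp_poly n.
Proof.
apply/polyP => i; rewrite coef_deriv !coef_poly ltnS.
case: ifP => _; last exact: mul0rn.
by rewrite factS natrM invrM ?units_nat ?unit_fact// -[LHS]mulr_natr divrK.
Qed.

(** The polynomial [g] obtained from the truncations of [exp] and of
    [log (1 + X)] at order [n] satisfies [(1 + X) g' = g] in degrees below
    [n - 1], and [g(0) = 1].  Where positive integers are invertible, this
    differential equation determines the coefficients one after the other, and
    [1 + X] solves it. *)
Lemma exp_log_poly n i :
  (i < n)%N -> (exp_poly n \Po log_poly n)`_i = (1 + 'X : {poly R})`_i.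
Proof.
case: n => [//|m]; set G := _ \Po _.
have G0 : G`_0 = 1.
  have [p Lp] := log_poly_factor m.+1.
  rewrite -horner_coef0 horner_comp Lp hornerM hornerX mul0r horner_coef0.
  by rewrite coef_poly/= invr1.
have [q Gq] : exists q, (1 + 'X) * G^`() = G + 'X^m * q.
  have [p Lp] := log_poly_factor m.+1.
  have expS : exp_poly m.+1 = exp_poly m + (m`!%:R)^-1 *: 'X^m.
    by rewrite /exp_poly !poly_def big_ord_recr.
  rewrite deriv_comp deriv_exp_poly mulrCA deriv_log_poly.
  (* Replacing exp_poly m by exp_poly m.+1 costs a multiple of log_poly ^+ m,
     hence of 'X^m. *)
  have -> : exp_poly m \Po log_poly m.+1 = G - (m`!%:R)^-1 *: ('X^m * p ^+ m).
    rewrite /G expS comp_polyD comp_polyZ rmorphXn/= comp_polyX.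
    by rewrite Lp exprMn addrK.
  rewrite [(- 'X) ^+ _]exprNn ['X^(m.+1)]exprSr.
  exists (- ((m`!%:R)^-1 *: p ^+ m) - (-1) ^+ m.+1 * 'X *
    (G - (m`!%:R)^-1 *: ('X^m * p ^+ m))).
  rewrite -!mul_polyC; move: (_ ^+ m.+1) (_^-1)%:P (p ^+ m) => s c r; ring.
have Grec j : (j < m)%N -> G`_j.+1 *+ j.+1 = G`_j - G`_j *+ j.
  move=> jm; have /(congr1 (fun p : {poly R} => p`_j)) := Gq.
  rewrite mulrDl mul1r !coefD coefXM coefXnM jm addr0 !coef_deriv => eqj.
  apply: (addIr (G`_j *+ j)); rewrite subrK -[RHS]eqj.
  by case: j {jm eqj}.
elim: i => [_|i IH im]; first by rewrite G0 coefD coef1 coefX addr0.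
apply: (mulIr (units_nat i)); rewrite !mulr_natr Grec// IH; last exact: ltnW.
rewrite !coefD !coef1 !coefX.
by case: i {IH im} => [|[|i]] /=;
  rewrite !(mulr0n, mulr1n, addr0, add0r, subr0, subrr, mul0rn, oppr0).
Qed.

End ExpLogPolynomials.

(** * Exponential and logarithm in a complete filtered algebra *)

Section Exponential.
Context (K : realType) (k : comPzRingType) (R : comUnitAlgType k).
Context (F : filtration R).
Hypothesis units_nat : forall n : nat, (n.+1%:R : R) \is a GRing.unit.
Implicit Types (x y : R) (n : nat) (p : {poly R}).

Lemma fil_sub_exp n i x y : x - y \in F n -> x ^+ i - y ^+ i \in F n.
Proof. by move=> xyF; rewrite subrXX filMr. Qed.

(** The assumption is on [p`_i * x ^+ i] as a whole, so that it
    covers [x] in [F 1] with any coefficients, and [x = 1] with coefficients in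
    the filtration. *)
Lemma horner_fil n p x : (forall i, (i < n)%N -> p`_i = 0) ->
  (forall i, p`_i * x ^+ i \in F i) -> p.[x] \in F n.
Proof.
move=> p0 pF; rewrite horner_coef rpred_sum// => i _.
have [/p0 ->|ni] := ltnP i n; first by rewrite mul0r rpred0.
exact: fil_le ni (pF i).
Qed.

(** The two sides have the same homogeneous parts of degree below [n], by the
    binomial theorem, and their other homogeneous parts lie in [F n]. *)
Lemma exp_poly_add n x y : x \in F 1%N -> y \in F 1%N ->
  (exp_poly R n).[x] * (exp_poly R n).[y] - (exp_poly R n).[x + y] \in F n.
Proof.
move=> xF yF; have xyF := rpredD xF yF.
(* The exponent of 'X records the degree; it is forgotten by evaluation at 1. *)
pose e z : {poly R} := \poly_(i < n) (z ^+ i / i`!%:R).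
have eE z : (exp_poly R n).[z] = (e z).[1].
  rewrite horner_exp_poly horner_poly.
  by apply: eq_bigr => i _; rewrite expr1n mulr1.
have eF z i : z \in F 1%N -> (e z)`_i \in F i.
  move=> zF; rewrite coef_poly.
  by case: ifP => _; rewrite ?rpred0// filMr// filX.
rewrite !eE -hornerM -hornerN -hornerD; apply: horner_fil => i; last first.
  rewrite expr1n mulr1 coefB rpredB ?eF// coefM rpred_sum// => j _.
  have := filM (eF x j xF) (eF y (i - j)%N yF).
  by rewrite subnKC// -ltnS.
move=> ni; rewrite coefB coefM coef_poly ni; apply/eqP; rewrite subr_eq0.
apply/eqP; rewrite addrC exprDn mulr_suml; apply: eq_bigr => j _.
have ji : (j <= i)%N := ltn_ord j.
rewrite !coef_poly (leq_ltn_trans ji ni) (leq_ltn_trans (leq_subr j i) ni).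
have bin_inv : (j`!%:R)^-1 * ((i - j)`!%:R)^-1 = 'C(i, j)%:R / i`!%:R :> R.
  rewrite -invrM ?unit_fact//.
  apply: (mulIr (unit_fact units_nat i)); rewrite divrK ?unit_fact//.
  rewrite -(bin_fact ji) natrM mulrCA [((_ - _)`!%:R * _)%R]mulrC -natrM.
  by rewrite mulVr ?mulr1// natrM unitrM !unit_fact.
by rewrite mulrACA bin_inv [x ^+ j * _]mulrC mulrA mulr_natr.
Qed.

Lemma horner_exp_log_poly n x : x \in F 1%N ->
  (exp_poly R n).[(log_poly R n).[x]] - (1 + x) \in F n.
Proof.
move=> xF; have <- : (1 + 'X).[x] = 1 + x by rewrite !hornerE.
rewrite -horner_comp -hornerN -hornerD; apply: horner_fil => i.
  by rewrite coefB => /(exp_log_poly units_nat) ->; rewrite subrr.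
by rewrite filMl// filX.
Qed.

Lemma fil_sub_exp_poly m n x y : x - y \in F n ->
  (exp_poly R m).[x] - (exp_poly R m).[y] \in F n.
Proof.
move=> xyF; rewrite !horner_exp_poly -sumrB rpred_sum// => i _.
by rewrite -mulrBl filMr// fil_sub_exp.
Qed.

Hypothesis complF : complete_filtration K F.

Lemma fexp_tail n x : x \in F 1%N -> fexp K F x - (exp_poly R n).[x] \in F n.
Proof.
move=> xF; rewrite horner_exp_poly; apply: (fsum_tail complF) => i /=.
by rewrite filMr// filX.
Qed.

Lemma fexpD x y : x \in F 1%N -> y \in F 1%N ->
  fexp K F (x + y) = fexp K F x * fexp K F y.
Proof.
move=> xF yF; apply: (@fil_eq _ _ F) => n.
apply: fil_trans (filBC _); last first.
  by apply: fil_subM; exact: fexp_tail.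
apply: fil_trans (filBC (exp_poly_add n xF yF)).
exact: fexp_tail (rpredD xF yF).
Qed.

Lemma fexp0 : fexp K F 0 = 1.
Proof.
have F0 : 0 \in F 1%N by exact: rpred0.
apply: (@fil_eq _ _ F) => n; have := fexp_tail n.+1 F0.
rewrite horner_exp_poly big_ord_recl big1 => [|i _]; last first.
  by rewrite exprS !mul0r.
by rewrite addr0 expr0 divr1; exact: filS.
Qed.

Lemma fexpK x : x \in F 1%N -> fexp K F x * fexp K F (- x) = 1.
Proof. by move=> xF; rewrite -fexpD ?rpredN// subrr fexp0. Qed.

Section Logarithm.
Context (lambda : k) (a : R).
Hypothesis aF : a \in F 1%N.

Let logF i : (- lambda) ^+ i *: (a ^+ i.+1 / i.+1%:R) \in F i.+1.
Proof. by rewrite rpredZ// filMr// filX. Qed.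

Lemma flog_tail n : flog K F lambda a -
  \sum_(i < n) (- lambda) ^+ i *: (a ^+ i.+1 / i.+1%:R) \in F n.
Proof. by apply: (fsum_tail complF) => i; apply: filS. Qed.

Lemma flog_fil : flog K F lambda a \in F 1%N.
Proof. by have := flog_tail 1; rewrite big_ord1 rpredBr. Qed.

Lemma fexp_flog : fexp K F (lambda *: flog K F lambda a) = 1 + lambda *: a.
Proof.
have laF : lambda *: a \in F 1%N by rewrite rpredZ.
apply: (@fil_eq _ _ F) => n; apply: fil_trans (horner_exp_log_poly n laF).
apply: fil_trans (fexp_tail n _) _; first by rewrite rpredZ ?flog_fil.
apply: fil_sub_exp_poly.
have -> : (log_poly R n).[lambda *: a] =
    lambda *: \sum_(i < n) (- lambda) ^+ i *: (a ^+ i.+1 / i.+1%:R).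
  rewrite scaler_sumr horner_sum; apply: eq_bigr => i _.
  rewrite hornerZ hornerXn exprZn scalerA [(- lambda) ^+ i]exprNn.
  rewrite mulrCA -exprS -scalerA.
  (* The sign is a power of -1 in R on one side and in k on the other. *)
  rewrite -(signr_odd R) -(signr_odd k) scaler_sign.
  rewrite -scalerAr mulrAC -mulrA mulr_sign.
  by case: odd; rewrite ?scalerN.
by rewrite -scalerBr rpredZ//; exact: flog_tail.
Qed.

End Logarithm.
End Exponential.

(** * The equation [b = P c + P (a b)] *)

Section FixedPoint.
Context (K : realType) (k : comPzRingType) (R : algType k).
Context (F : filtration R) (P : {linear R -> R}) (a c b : R).
Hypothesis P_fil : forall n x, x \in F n -> P x \in F n.
Hypothesis aF : a \in F 1%N.
Hypothesis bE : b = P c + P (a * b).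

Lemma fixed_point_unique b' : b' = P c + P (a * b') <-> b' = b.
Proof.
split=> [b'E|-> //]; apply: (@fil_eq _ _ F); elim=> [|n IH]; first exact: fil0.
rewrite b'E bE [P c + _]addrC addrKA -raddfB -mulrBr; apply: P_fil.
by rewrite -add1n filM.
Qed.

(** Since [P c] is the first nested term and [t |-> P (a t)] maps each nested
    term to the next, the equation says that the remainder of order [n + 1] is
    the image of the remainder of order [n]. *)
Lemma fixed_point_nested : fsum_to K F (nested P a c) b.
Proof.
apply: fsum_to_tail; elim=> [|n IH]; first exact: fil0.
rewrite big_ord_recl -[nested _ _ _ ord0]/(P c) {1}bE [P c + _]addrC addrKA.
have -> : \sum_(i < n) nested P a c (bump 0 i) =
    P (a * \sum_(i < n) nested P a c i).
  by rewrite mulr_sumr raddf_sum.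
by rewrite -raddfB -mulrBr; apply: P_fil; rewrite -add1n filM.
Qed.

End FixedPoint.

(** * Rota-Baxter operators and Spitzer's identity *)

Section RotaBaxter.
Context (K : realType) (k : comPzRingType) (lambda : k) (R : comUnitAlgType k).
Context (F : filtration R) (P : {linear R -> R}).
Hypothesis units_nat : forall n : nat, (n.+1%:R : R) \is a GRing.unit.
Hypothesis RB : rota_baxter lambda P.
Hypothesis complF : complete_filtration K F.
Hypothesis P_fil : forall n x, x \in F n -> P x \in F n.
Implicit Types (x y a : R) (f : {linear R -> R}).

(** This is the Rota-Baxter identity at [a e] and [e' c], where [P (a e)] is
    replaced by [e - 1] wherever it occurs. *)
Lemma solution_of_factor a c e e' : e * e' = 1 -> e = 1 + P (a * e) ->
  let b := e * P (e' * c) in b = P ((1 + lambda *: a) * c) + P (a * b).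
Proof.
move=> ee' eE b.
have PaeE : P (a * e) = e - 1 by rewrite {2}eE addrAC subrr add0r.
have := RB (a * e) (e' * c).
rewrite {1 2}PaeE mulrBl mul1r mulrBl mul1r raddfB /= !mulrA ee' mul1r.
rewrite -[_ * e * e']mulrA ee' mulr1 -[a * e * _]mulrA -/b => /eqP.
rewrite subr_eq => /eqP bE; rewrite [LHS]bE.
rewrite mulrDl mul1r -scalerAl linearD linearZ_LR; ring.
Qed.

(** Integers need not be invertible in [k], so this is not a case of linearity:
    it comes from additivity and cancellation. *)
Lemma linear_div f x n : f (x / n.+1%:R) = f x / n.+1%:R.
Proof.
apply: (mulIr (units_nat n)); rewrite divrK ?units_nat//.
by rewrite mulr_natr -raddfMn -[X in f X = _]mulr_natr divrK ?units_nat.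
Qed.

(** The double product of the Rota-Baxter algebra, for which [P] and
    [lambda + P] are both multiplicative. *)
Definition star x y : R := x * P y + P x * y + lambda *: (x * y).

(** Indexed from the first power on, as [star] has no unit. *)
Definition star_pow x n : R := iter n (star x) x.

Lemma P_star x y : P (star x y) = P x * P y.
Proof. by rewrite RB /star !linearD linearZ_LR. Qed.

Lemma lambdaP_star x y : lambda *: star x y + P (star x y) =
  (lambda *: x + P x) * (lambda *: y + P y).
Proof.
rewrite P_star /star !scalerDr mulrDl !mulrDr -!scalerAl -!scalerAr.
ring.
Qed.

Lemma star_pow_fil x n : x \in F 1%N -> star_pow x n \in F n.+1.
Proof.
move=> xF; elim: n => [//|n IH] /=; rewrite -add1n.
by rewrite /star !rpredD ?rpredZ ?filM ?P_fil.
Qed.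

Definition star_exp_sub1 x : R :=
  fsum K F (fun n => star_pow x n / n.+1`!%:R).

(** To be used with [f = P] and [f = lambda + P], which are multiplicative from
    the double product to the product. *)
Lemma linear_star_exp f x y : x \in F 1%N -> y \in F 1%N ->
  (forall n u, u \in F n -> f u \in F n) ->
  (forall n, f (star_pow x n) = y ^+ n.+1) ->
  f (star_exp_sub1 x) = fexp K F y - 1.
Proof.
move=> xF yF fF fpow; apply: (@fil_eq _ _ F) => n.
pose S := \sum_(i < n) star_pow x i / i.+1`!%:R.
apply: (fil_trans (y := f S)).
  rewrite -raddfB; apply: fF; apply: (fsum_tail complF) => i /=.
  by rewrite filMr// filS// star_pow_fil.
have -> : f S = (exp_poly R n.+1).[y] - 1.
  rewrite horner_exp_poly big_ord_recl expr0 divr1 addrAC subrr add0r.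
  rewrite raddf_sum; apply: eq_bigr => i _ /=.
  have := linear_div f (star_pow x i) (i.+1)`!.-1.
  by rewrite prednK ?fact_gt0// fpow.
rewrite opprB addrA subrK; apply/filBC/filS.
exact: fexp_tail.
Qed.

(** With [w] the exponential series of [x] for the double product, without its
    constant term, applying [P] and [lambda + P] to [w] gives
    [P w = E - 1] and [lambda w + P w = (1 + lambda a) E - 1], where
    [E = exp (P x)]; cancelling [lambda] in the difference leaves [w = a E]. *)
Lemma spitzer x a : (forall y, lambda *: y = 0 -> y = 0) -> x \in F 1%N ->
  fexp K F (lambda *: x) = 1 + lambda *: a ->
  fexp K F (P x) = 1 + P (a * fexp K F (P x)).
Proof.
move=> lambda_reg xF expE.
have PxF := P_fil xF; have lxF : lambda *: x \in F 1%N by rewrite rpredZ.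
set w := star_exp_sub1 x; set E := fexp K F (P x).
have Pw : P w = E - 1.
  apply: linear_star_exp => // n.
  by elim: n => [//|n IH] /=; rewrite P_star IH -exprS.
have Qw : lambda *: w + P w = (1 + lambda *: a) * E - 1.
  rewrite -expE -(fexpD units_nat complF)//.
  apply: (@linear_star_exp (lambda \*: idfun \+ P)) => //.
  - exact: rpredD.
  - by move=> n u uF /=; rewrite rpredD ?rpredZ ?P_fil.
  - by elim=> [//|n IH]; rewrite [LHS]lambdaP_star [X in _ * X]IH -exprS.
suff wE : w = a * E by rewrite -wE Pw addrC subrK.
apply/eqP; rewrite -subr_eq0; apply/eqP/lambda_reg; rewrite scalerBr.
move: Qw; rewrite Pw mulrDl mul1r -scalerAl addrA => /addIr.
by rewrite addrC => /addrI ->; rewrite subrr.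
Qed.

(** In weight 0 the terms of the series are computed directly: with
    [y n = a (P a)^n / n!], the Rota-Baxter identity at [a] and [y n] reads
    [P a P (y n) = (n + 2) P (y (n + 1))], which is the induction step. *)
Lemma spitzer_weight0 a : lambda = 0 -> a \in F 1%N ->
  fexp K F (P a) = 1 + P (a * fexp K F (P a)).
Proof.
move=> lambda0 aF; have PaF := P_fil aF.
have Ppow n : P (a * (P a ^+ n / n`!%:R)) = P a ^+ n.+1 / n.+1`!%:R.
  elim: n => [|n IH]; first by rewrite expr0 expr1 !divr1 mulr1.
  pose y i := a * (P a ^+ i / i`!%:R); rewrite -[LHS]/(P (y n.+1)).
  have Pay : P a * y n = y n.+1 *+ n.+1.
    rewrite /y factS natrM invrM ?units_nat ?unit_fact// -mulrnAr -mulrnAr.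
    by rewrite -[in RHS]mulr_natr divrK ?units_nat// exprS -mulrA mulrCA.
  have := RB a (y n).
  rewrite lambda0 scale0r addr0 IH -/(y n.+1) Pay raddfMn /=.
  rewrite -mulrS => PyE; apply: (mulIr (units_nat n.+1)).
  rewrite mulr_natr -PyE mulrA -exprS (factS n.+1) natrM.
  rewrite invrM ?units_nat ?unit_fact//.
  by rewrite !mulrA divrK ?units_nat.
apply: (@fil_eq _ _ F) => n; apply: filS.
apply: (fil_trans (fexp_tail complF n.+1 PaF)).
rewrite horner_exp_poly big_ord_recl expr0 divr1 [1 + _]addrC addrKA.
have -> : \sum_(i < n) P a ^+ (bump 0 i) / (bump 0 i)`!%:R =
  P (a * (exp_poly R n).[P a]).
  rewrite horner_exp_poly mulr_sumr raddf_sum.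
  by apply: eq_bigr => i _; rewrite /= Ppow.
rewrite -raddfB -mulrBr; apply: P_fil; rewrite -add1n filM//.
by apply/filBC/fexp_tail.
Qed.

End RotaBaxter.

(** * Solution of the equation *)

Theorem theorem1 (K : realType) (k : comPzRingType) (lambda : k)
    (R : comUnitAlgType k) (F : filtration R) (P : {linear R -> R})
    (a0 a1 : R)
    (units_nat : forall n : nat, (n.+1%:R : R) \is a GRing.unit)
    (cfRB : complete_filtered_rota_baxter K lambda F P)
    (a0F : a0 \in F 1%N) (a1F : a1 \in F 1%N) :
  ((forall x : R, lambda *: x = 0 -> x = 0) ->
    let U := P (flog K F lambda a1) in
    let sol := fexp K F U * P (fexp K F (- U) * a0) in
    (forall b : R,
      b = P ((1 + lambda *: a1) * a0) + P (a1 * b) <-> b = sol) /\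
    fsum_to K F (nested P a1 ((1 + lambda *: a1) * a0)) sol) /\
  (lambda = 0 ->
    let sol := fexp K F (P a1) * P (fexp K F (- P a1) * a0) in
    (forall b : R,
      b = P ((1 + lambda *: a1) * a0) + P (a1 * b) <-> b = sol) /\
    fsum_to K F (nested P a1 a0) sol).
Proof.
have [RB complF P_fil] := cfRB; split=> [lambda_reg U sol|lambda0 sol].
  have lF := flog_fil complF lambda a1F.
  have solE : sol = P ((1 + lambda *: a1) * a0) + P (a1 * sol).
    apply: solution_of_factor => //; first by rewrite fexpK// P_fil.
    exact: (spitzer units_nat RB complF P_fil lambda_reg lF
    (fexp_flog units_nat complF lambda a1F)).
  split; first exact: (fixed_point_unique P_fil a1F solE).
  exact: (fixed_point_nested P_fil a1F solE).
have solE : sol = P ((1 + lambda *: a1) * a0) + P (a1 * sol).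
  apply: solution_of_factor => //; first by rewrite fexpK// P_fil.
  exact: (spitzer_weight0 units_nat RB complF P_fil lambda0 a1F).
split; first exact: (fixed_point_unique P_fil a1F solE).
have := fixed_point_nested P_fil a1F solE.
by rewrite lambda0 scale0r addr0 mul1r.
Qed.
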